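(* Let $G$ be a group such that $\mathrm{Aut}(G)$ is residually finite, and let $H$ be an AS subgroup of $G$. Then the quotient map $f : \mathrm{Aut}(G) \to \mathrm{Out}(G)$ splits virtually. In particular $\mathrm{Out}(G)$ is residually finite.
   Context: For a group $G$, $\mathrm{Inn}(G)$ is the group of inner automorphisms, $\mathrm{Out}(G) = \mathrm{Aut}(G)/\mathrm{Inn}(G)$, and $f : \mathrm{Aut}(G) \to \mathrm{Out}(G)$ is the quotient map. For a subgroup $H$ of $G$, $\mathrm{Aut}_{\underline{H}}(G)$ is the subgroup of automorphisms of $G$ that fix $H$ pointwise. The subgroup $H$ is an AS subgroup ($\mathrm{Aut}$-splitting subgroup) of $G$ if the kernel of $f|_{\mathrm{Aut}_{\underline{H}}(G)}$ is finite and $f(\mathrm{Aut}_{\underline{H}}(G))$ has finite index in $\mathrm{Out}(G)$. A group epimorphism $f : A \to B$ splits virtually if there exist a finite index subgroup $B' < B$ and a homomorphism $g : B' \to A$ with $f \circ g = \mathrm{Id}_{B'}$. A group is residually finite if the intersection of its finite index subgroups is trivial. *)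

(* Defs.v *)
From HB Require Import structures.
From mathcomp Require Import all_boot all_classical.

Set Implicit Arguments.
Unset Strict Implicit.
Unset Printing Implicit Defensive.

Local Open Scope classical_set_scope.
Local Open Scope quotient_scope.
Local Open Scope group_scope.

Section Subgroups.
Context (G : groupType).

Definition is_subgroup (H : set G) : Prop := group_closed [in H].

Definition left_coset (H : set G) (x : G) : set G := [set x * h | h in H].

Definition finite_index (H : set G) : Prop :=
  is_subgroup H /\ finite_set (range (left_coset H)).

Definition residually_finite : Prop :=
  \bigcap_(K in [set K : set G | finite_index K]) K = [set 1].

End Subgroups.

Arguments residually_finite G : clear implicits.

Record normal_subgroup (G : groupType) := NormalSubgroup {
  normal_set :> set G;
  normal_is_subgroup : is_subgroup normal_set;
  normal_conj : forall x y, normal_set x -> normal_set (x ^ y)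
}.

Section Quotient.
Context (G : groupType) (N : normal_subgroup G).

Definition coset_rel (x y : G) : bool := x^-1 * y \in (N : set G).

Let N1 : 1 \in (N : set G).
Proof. by have [] := normal_is_subgroup N. Qed.

Let NM x y : x \in (N : set G) -> y \in (N : set G) -> x * y \in (N : set G).
Proof. exact: (group_closedM (normal_is_subgroup N)). Qed.

Let NV x : x \in (N : set G) -> x^-1 \in (N : set G).
Proof. exact: (group_closedV (normal_is_subgroup N)). Qed.

Let NJ x y : x \in (N : set G) -> x ^ y \in (N : set G).
Proof. by rewrite !inE; exact: normal_conj. Qed.

Lemma coset_rel_refl : reflexive coset_rel.
Proof. by move=> x; rewrite /coset_rel mulVg. Qed.

Lemma coset_rel_sym : symmetric coset_rel.
Proof.
by move=> x y; apply/idP/idP => /NV; rewrite /coset_rel invgM invgK.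
Qed.

Lemma coset_rel_trans : transitive coset_rel.
Proof.
move=> y x z xy yz; rewrite /coset_rel.
by have := NM xy yz; rewrite -mulgA mulVKg.
Qed.

Canonical coset_equiv :=
  EquivRel coset_rel coset_rel_refl coset_rel_sym coset_rel_trans.

Definition quot_group : Type := {eq_quot coset_equiv}.

HB.instance Definition _ := Choice.on quot_group.
HB.instance Definition _ := Quotient.on quot_group.

Definition quot_one : quot_group := \pi_quot_group 1.
Definition quot_inv (u : quot_group) : quot_group :=
  \pi_quot_group (repr u)^-1.
Definition quot_mul (u v : quot_group) : quot_group :=
  \pi_quot_group (repr u * repr v).

Lemma eq_quot_map (x y : G) :
  (\pi_quot_group x = \pi_quot_group y) <-> (x^-1 * y \in (N : set G)).
Proof. by split => [/eqmodP|H]; last exact/eqmodP. Qed.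

Lemma quot_inv_pi x : quot_inv (\pi_quot_group x) = \pi_quot_group x^-1.
Proof.
rewrite /quot_inv; set u := repr _; apply/eq_quot_map; rewrite invgK.
have ux : u^-1 * x \in (N : set G) by apply/eq_quot_map; rewrite reprK.
suff -> : u * x^-1 = (u^-1 * x)^-1 ^ x^-1 by exact/NJ/NV.
by rewrite conjgE invgM !invgK !mulgA mulgV mul1g.
Qed.

Lemma quot_mul_pi x y :
  quot_mul (\pi_quot_group x) (\pi_quot_group y) = \pi_quot_group (x * y).
Proof.
rewrite /quot_mul; set u := repr _; set v := repr _; apply/eq_quot_map.
have ux : u^-1 * x \in (N : set G) by apply/eq_quot_map; rewrite reprK.
have vy : v^-1 * y \in (N : set G) by apply/eq_quot_map; rewrite reprK.
suff -> : (u * v)^-1 * (x * y) = (u^-1 * x) ^ v * (v^-1 * y) by exact/NM/vy/NJ.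
by rewrite conjgE invgM -!mulgA mulVKg.
Qed.

Lemma quot_mulA : associative quot_mul.
Proof.
elim/quotW=> x; elim/quotW=> y; elim/quotW=> z.
by rewrite (quot_mul_pi y z) (quot_mul_pi x y) (quot_mul_pi x (y * z))
           (quot_mul_pi (x * y) z) mulgA.
Qed.

Lemma quot_mul1 : left_id quot_one quot_mul.
Proof. by elim/quotW=> x; rewrite quot_mul_pi mul1g. Qed.

Lemma quot_1mul : right_id quot_one quot_mul.
Proof. by elim/quotW=> x; rewrite quot_mul_pi mulg1. Qed.

Lemma quot_mulV : left_inverse quot_one quot_inv quot_mul.
Proof. by elim/quotW=> x; rewrite quot_inv_pi quot_mul_pi mulVg. Qed.

Lemma quot_Vmul : right_inverse quot_one quot_inv quot_mul.
Proof. by elim/quotW=> x; rewrite quot_inv_pi quot_mul_pi mulgV. Qed.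

HB.instance Definition _ :=
  isGroup.Build quot_group quot_mulA quot_mul1 quot_1mul quot_mulV quot_Vmul.

Definition quot_map (x : G) : quot_group := \pi_quot_group x.

Lemma quot_mapM : {morph quot_map : x y / x * y}.
Proof. by move=> x y; rewrite /quot_map -quot_mul_pi. Qed.

HB.instance Definition _ := isMultiplicative.Build G quot_group quot_map quot_mapM.

Lemma quot_map_surj : range quot_map = [set: quot_group].
Proof.
by apply/seteqP; split => // u _; exists (repr u) => //; exact: reprK.
Qed.

Lemma quot_map_eq1 x : quot_map x = 1 <-> x \in (N : set G).
Proof.
apply: (iff_trans (eq_quot_map x 1)); rewrite mulg1.
by split=> /NV //; rewrite invgK.
Qed.

End Quotient.

Section Automorphisms.
Context (G : groupType).

Definition is_automorphism (a : G -> G) : Prop :=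
  bijective a /\ {morph a : x y / x * y}.

Record Aut := MkAut {
  aut_fun :> G -> G;
  aut_funP : `[< is_automorphism aut_fun >]
}.

HB.instance Definition _ := [isSub for aut_fun].
HB.instance Definition _ := [Choice of Aut by <:].

Lemma aut_bij (a : Aut) : bijective a.
Proof. by have /asboolP[] := aut_funP a. Qed.

Lemma autM (a : Aut) : {morph a : x y / x * y}.
Proof. by have /asboolP[] := aut_funP a. Qed.

HB.instance Definition _ (a : Aut) := isMultiplicative.Build G G a (autM a).

Lemma aut_ext (a b : Aut) : a =1 b -> a = b.
Proof. by move=> ab; apply/val_inj/funext. Qed.

Fact aut_one_subproof : `[< is_automorphism idfun >].
Proof. by apply/asboolP; split => //; exists idfun. Qed.
Definition aut_one := MkAut aut_one_subproof.

Fact aut_mul_subproof (a b : Aut) : `[< is_automorphism (a \o b) >].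
Proof.
apply/asboolP; split; first exact: bij_comp (aut_bij a) (aut_bij b).
by move=> x y /=; rewrite !autM.
Qed.
Definition aut_mul (a b : Aut) := MkAut (aut_mul_subproof a b).

Definition aut_inv_fun (a : Aut) (y : G) : G := xget 1 [set x | a x = y].

Lemma aut_inv_funK (a : Aut) : cancel (aut_inv_fun a) a.
Proof.
move=> y; rewrite /aut_inv_fun; case: xgetP => //= /(_ _) nex.
by have [b _ bK] := aut_bij a; case: (nex (b y)); exact: bK.
Qed.

Lemma aut_funK (a : Aut) : cancel a (aut_inv_fun a).
Proof. by move=> x; apply: (bij_inj (aut_bij a)); rewrite aut_inv_funK. Qed.

Fact aut_inv_subproof (a : Aut) : `[< is_automorphism (aut_inv_fun a) >].
Proof.
apply/asboolP; split; first by exists a; [exact: aut_inv_funK | exact: aut_funK].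
by apply: can2_gmulfM; [exact: aut_funK | exact: aut_inv_funK].
Qed.
Definition aut_inv (a : Aut) := MkAut (aut_inv_subproof a).

Lemma aut_mulA : associative aut_mul.
Proof. by move=> a b c; exact: aut_ext. Qed.

Lemma aut_mul1 : left_id aut_one aut_mul.
Proof. by move=> a; exact: aut_ext. Qed.

Lemma aut_1mul : right_id aut_one aut_mul.
Proof. by move=> a; exact: aut_ext. Qed.

Lemma aut_mulV : left_inverse aut_one aut_inv aut_mul.
Proof. by move=> a; apply: aut_ext; exact: aut_funK. Qed.

Lemma aut_Vmul : right_inverse aut_one aut_inv aut_mul.
Proof. by move=> a; apply: aut_ext; exact: aut_inv_funK. Qed.

HB.instance Definition _ :=
  isGroup.Build Aut aut_mulA aut_mul1 aut_1mul aut_mulV aut_Vmul.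

Definition inner_automorphisms : set Aut :=
  [set a : Aut | exists g : G, forall x, a x = g * x * g^-1].

Lemma inner_automorphisms_subgroup : is_subgroup inner_automorphisms.
Proof.
split; first by rewrite !inE; exists 1 => x; rewrite mul1g invg1 mulg1.
move=> a b; rewrite !inE => -[g ag] [h bh]; exists (g * h^-1) => x.
suff -> : (a / b) x = a (h^-1 * x * h) by rewrite ag invgM invgK !mulgA.
congr (a _); apply: (bij_inj (aut_bij b)).
transitivity x; first exact: aut_inv_funK.
by rewrite bh !mulgA mulgV mul1g mulgK.
Qed.

Lemma inner_automorphisms_conj (a b : Aut) :
  inner_automorphisms a -> inner_automorphisms (a ^ b).
Proof.
move=> [g ag]; exists (b^-1 g) => x.
change (b^-1 (a (b x)) = b^-1 g * x * (b^-1 g)^-1).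
apply: (bij_inj (aut_bij b)).
have bK y : b (b^-1 y) = y by exact: aut_inv_funK.
have bV y : b y^-1 = (b y)^-1.
  by apply/esym/mulg1_eq; rewrite -autM mulgV -[RHS](mulgV (b 1)) -{2}[1]mulg1 autM mulgK.
by rewrite bK ag !autM bV bK.
Qed.

Definition Inn : normal_subgroup Aut :=
  NormalSubgroup inner_automorphisms_subgroup inner_automorphisms_conj.

Definition Out : Type := quot_group Inn.
HB.instance Definition _ := Group.on Out.

Definition Aut_to_Out : {multiplicative Aut -> Out} := @quot_map Aut Inn.

Lemma Aut_to_Out_surj : range Aut_to_Out = [set: Out].
Proof. exact: quot_map_surj. Qed.

Lemma Aut_to_Out_eq1 (a : Aut) : Aut_to_Out a = 1 <-> inner_automorphisms a.
Proof.
by apply: (iff_trans (@quot_map_eq1 Aut Inn a)); rewrite inE.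
Qed.

Definition Aut_fixing (H : set G) : set Aut :=
  [set a : Aut | forall x, H x -> a x = x].

Definition AS_subgroup (H : set G) : Prop :=
  [/\ is_subgroup H,
      finite_set (Aut_fixing H `&` Aut_to_Out @^-1` [set 1]) &
      finite_index (Aut_to_Out @` Aut_fixing H)].

End Automorphisms.

(** As for partial morphisms in [fingroup], a homomorphism defined on the
    subgroup [B'] is a total function that is multiplicative on [B']; its values
    outside [B'] are irrelevant. *)
Definition splits_virtually (A B : groupType) (f : {multiplicative A -> B}) :
  Prop :=
  exists (B' : set B) (g : B -> A),
    [/\ finite_index B',
        {in B' &, {morph g : x y / x * y}} &
        {in B', cancel g f}].

(* Main.v *)
Require Import Defs.
From HB Require Import structures.
From mathcomp Require Import all_boot all_classical.

(** The theorem holds for any morphism [f : A -> B] out of a residually finite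
    group, given a subgroup [C] of [A] such that [C] meets the kernel of [f] in
    a finite set and [f @` C] has finite index in [B].

    Residual finiteness of [A] provides a finite index subgroup [L] of [A] that
    avoids the finitely many nontrivial elements of [C] in the kernel
    ([residually_finite_separates]). Hence [f] is injective on [C `&` L].
    Cutting [C] down by a finite index subgroup preserves the finite index of
    its image ([finite_index_imageI]), so [f @` (C `&` L)] has finite index in
    [B], and the inverse of [f] on it is a virtual splitting.

    The group [B] is then residually finite because it has a finite index
    subgroup isomorphic to a subgroup of [A]: a nontrivial element outside
    [f @` (C `&` L)] is avoided by that subgroup, and a nontrivial element
    [f a] with [a] in [C `&` L] is avoided by [f @` (C `&` (L `&` M))], where
    [M] is a finite index subgroup of [A] that avoids [a].

    An AS subgroup [H] gives this situation, with [f] the map from [Aut G] to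
    [Out G] and [C] the automorphisms fixing [H] pointwise. *)

Set Implicit Arguments.
Unset Strict Implicit.
Unset Printing Implicit Defensive.

Local Open Scope classical_set_scope.
Local Open Scope group_scope.

Section FiniteIndex.
Context (G : groupType).
Implicit Types H K : set G.

Lemma is_subgroupP H :
  is_subgroup H <-> H 1 /\ forall x y, H x -> H y -> H (x^-1 * y).
Proof.
split=> [sH|[H1 HVM]].
  split=> [|x y Hx Hy]; first by have [] := sH; rewrite inE.
  have := group_closedM sH; have := group_closedV sH.
  by move=> HV HM; apply/set_mem/HM; [exact/HV/mem_set | exact/mem_set].
have HV x : H x -> H x^-1 by move=> Hx; rewrite -[x^-1]mulg1; exact: HVM.
split=> [|x y]; rewrite !inE // => Hx Hy.
by rewrite -[x]invgK; apply: HVM; exact: HV.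
Qed.

Lemma is_subgroupI H K :
  is_subgroup H -> is_subgroup K -> is_subgroup (H `&` K).
Proof.
move=> /is_subgroupP[H1 HV] /is_subgroupP[K1 KV]; apply/is_subgroupP.
by split=> [|x y [Hx Kx] [Hy Ky]]; split; auto.
Qed.

Lemma left_coset_eqP H : is_subgroup H ->
  forall x y, left_coset H x = left_coset H y <-> H (x^-1 * y).
Proof.
move=> /is_subgroupP[H1 HVM] x y.
have HV z : H z -> H z^-1 by move=> Hz; rewrite -[z^-1]mulg1; exact: HVM.
have HM u v : H u -> H v -> H (u * v).
  by move=> Hu Hv; rewrite -[u]invgK; apply: HVM => //; exact: HV.
split=> [exy|Hxy].
  have : left_coset H y y by exists 1; rewrite ?mulg1.
  by rewrite -exy => -[h Hh <-]; rewrite mulKg.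
apply/seteqP; split=> _ [h Hh <-].
  exists ((x^-1 * y)^-1 * h); first exact: HVM.
  by rewrite invgM invgK -!mulgA mulVKg.
exists (x^-1 * y * h); first exact: HM.
by rewrite -!mulgA mulVKg.
Qed.

(** Counting cosets reduces to exhibiting a finite colouring whose colour
    classes lie inside single cosets; this avoids choosing transversals of
    intersections and of images. *)
Lemma finite_index_colouring (T : Type) (c : G -> T) H :
  is_subgroup H -> finite_set (range c) ->
  (forall x y, c x = c y -> H (x^-1 * y)) -> finite_index H.
Proof.
move=> sH finc cH; split=> //.
pose rep t := xget 1 [set x | c x = t].
apply: (sub_finite_set _ (finite_image (left_coset H \o rep) finc)).
move=> _ [x _ <-]; exists (c x); first by exists x.
apply/left_coset_eqP => //; apply: cH.
by rewrite /rep; case: xgetP => // nox; case: (nox x).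
Qed.

Lemma finite_index_setT : finite_index [set: G].
Proof.
apply: (@finite_index_colouring unit (fun=> tt)) => //.
exact/is_subgroupP.
Qed.

Lemma finite_index_setI H K :
  finite_index H -> finite_index K -> finite_index (H `&` K).
Proof.
move=> [sH finH] [sK finK].
apply: (@finite_index_colouring _ (fun x => (left_coset H x, left_coset K x))).
- exact: is_subgroupI.
- apply: (sub_finite_set _ (finite_setX finH finK)) => _ [x _ <-].
  by split; exists x.
- by move=> x y [exH exK]; split; apply/left_coset_eqP.
Qed.

Lemma residually_finite_avoid x : residually_finite G -> x <> 1 ->
  exists2 K : set G, finite_index K & ~ K x.
Proof.
move=> rfG x1; apply: contrapT => nK; apply: x1.
suff : [set 1 : G] x by [].
rewrite -rfG => K Kfin; apply: contrapT => Kx.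
by apply: nK; exists K.
Qed.

(** In a residually finite group, not only one nontrivial element but
    finitely many are avoided at once: finite index subgroups are stable under
    finite intersections. *)
Lemma residually_finite_separates (S : set G) :
  residually_finite G -> finite_set S ->
  exists2 K : set G, finite_index K & forall x, K x -> S x -> x = 1.
Proof.
move=> rfG /finite_seqP[s ->].
elim: s => [|a s [K fK Ks]]; first by exists [set: G]; [exact: finite_index_setT|].
have [a1|a1] := pselect (a = 1).
  exists K => // x Kx; rewrite /= inE => /orP[/eqP-> //|]; exact: Ks.
have [L fL La] := residually_finite_avoid rfG a1.
exists (L `&` K); first exact: finite_index_setI.
move=> x [Lx Kx]; rewrite /= inE => /orP[/eqP xa|]; last exact: Ks.
by case: La; rewrite -xa.
Qed.

Lemma residually_finiteP :
  (forall x : G, x <> 1 -> exists2 K : set G, finite_index K & ~ K x) ->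
  residually_finite G.
Proof.
move=> avoid; apply/seteqP; split=> [x xK|_ -> K [/is_subgroupP[]] //].
apply: contrapT => x1; have [K fK Kx] := avoid x x1.
by apply: Kx; exact: (xK K fK).
Qed.

End FiniteIndex.

Section VirtualSplitting.
Context (A B : groupType) (f : {multiplicative A -> B}).
Implicit Types C L : set A.

Let f1 : f 1 = 1.
Proof. by apply: (mulgI (f 1)); rewrite -gmulfM !mulg1. Qed.

Let fVM a b : f (a^-1 * b) = (f a)^-1 * f b.
Proof. by apply: (mulgI (f a)); rewrite -gmulfM !mulVKg. Qed.

Lemma is_subgroup_image C : is_subgroup C -> is_subgroup (f @` C).
Proof.
move=> /is_subgroupP[C1 CVM]; apply/is_subgroupP; split.
  by exists 1.
move=> _ _ [a Ca <-] [b Cb <-]; exists (a^-1 * b); first exact: CVM.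
exact: fVM.
Qed.

(** Every [y : B] is [r * f a], with [r] a fixed representative of the coset
    of [y] modulo [f @` C] and [a] in [C]; the pair made of the coset of [y]
    and of the coset of [a] modulo [L] then determines [y] modulo
    [f @` (C `&` L)]. *)
Lemma finite_index_imageI C L : is_subgroup C ->
  finite_index (f @` C) -> finite_index L -> finite_index (f @` (C `&` L)).
Proof.
move=> sC [sD finD] [sL finL].
pose q := left_coset (f @` C).
pose r y := xget 1 [set x | q x = q y].
pose a y := xget 1 [set b | C b /\ f b = (r y)^-1 * y].
have aP y : C (a y) /\ f (a y) = (r y)^-1 * y.
  rewrite /a; case: xgetP => [_ _ //|noa].
  have : (f @` C) ((r y)^-1 * y).
    apply/(left_coset_eqP sD); rewrite /r.
    by case: xgetP => // nor; case: (nor y erefl).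
  by move=> [b Cb fb]; case: (noa b).
apply: (@finite_index_colouring _ _ (fun y => (q y, left_coset L (a y)))).
- by apply: is_subgroup_image; apply: is_subgroupI.
- apply: (sub_finite_set _ (finite_setX finD finL)) => _ [y _ <-].
  by split; [exists y | exists (a y)].
move=> x y [exy eaxy].
have erxy : r x = r y by rewrite /r exy.
have [[Cx fx] [Cy fy]] := (aP x, aP y).
exists ((a x)^-1 * a y).
  split; last exact/left_coset_eqP.
  by have /is_subgroupP[_] := sC; apply.
by rewrite fVM fx fy erxy invgM invgK -!mulgA mulVKg.
Qed.

(** Elements of [C] with the same image differ by an element of [C] in the
    kernel, so [L] only has to separate this finite kernel from 1. *)
Lemma finite_index_inj_on C :
  residually_finite A -> is_subgroup C ->
  finite_set (C `&` f @^-1` [set 1]) ->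
  exists2 L, finite_index L &
    forall a b, (C `&` L) a -> (C `&` L) b -> f a = f b -> a = b.
Proof.
move=> rfA sC finker.
have [L fL L1] := residually_finite_separates rfA finker.
exists L => // a b CLa CLb fab.
have /is_subgroupP[_ CLVM] := is_subgroupI sC (proj1 fL).
have [Cab Lab] := CLVM _ _ CLa CLb.
have ab1 : a^-1 * b = 1.
  by apply: L1 => //; split=> //=; rewrite fVM fab mulVg.
by rewrite -[b](mulVKg a) ab1 mulg1.
Qed.

Lemma splits_virtually_inj_on C : is_subgroup C -> finite_index (f @` C) ->
  (forall a b, C a -> C b -> f a = f b -> a = b) -> splits_virtually f.
Proof.
move=> sC fD finj.
pose g u := xget 1 [set a | C a /\ f a = u].
have gP u : u \in f @` C -> C (g u) /\ f (g u) = u.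
  rewrite inE => -[a Ca fa]; rewrite /g; case: xgetP => // nog.
  by case: (nog a).
have CM a b : C a -> C b -> C (a * b).
  move=> Ca Cb; apply/set_mem.
  by apply: (group_closedM sC); exact/mem_set.
exists (f @` C), g; split=> // [u v Du Dv|u /gP[]//].
have [[Cu fu] [Cv fv]] := (gP u Du, gP v Dv).
have Duv : u * v \in f @` C.
  by rewrite inE; exists (g u * g v); [exact: CM | rewrite gmulfM fu fv].
have [Cuv fuv] := gP _ Duv.
by apply: finj => //; [exact: CM | rewrite fuv gmulfM fu fv].
Qed.

Lemma residually_finite_inj_on C :
  residually_finite A -> is_subgroup C -> finite_index (f @` C) ->
  (forall a b, C a -> C b -> f a = f b -> a = b) -> residually_finite B.
Proof.
move=> rfA sC fD finj; apply: residually_finiteP => u u1.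
have [[a Ca fa]|Du] := pselect ((f @` C) u); last by exists (f @` C).
have a1 : a <> 1 by move=> a1; apply: u1; rewrite -fa a1 f1.
have [M fM Ma] := residually_finite_avoid rfA a1.
exists (f @` (C `&` M)); first exact: finite_index_imageI.
move=> [b [Cb Mb] fb]; apply: Ma.
by rewrite (finj a b) // fa fb.
Qed.

End VirtualSplitting.

Lemma Aut_fixing_subgroup (G : groupType) (H : set G) :
  is_subgroup (Aut_fixing H).
Proof.
apply/is_subgroupP; split=> // a b aH bH x Hx.
change (aut_inv a (b x) = x); rewrite bH // -{1}(aH x Hx).
exact: aut_funK.
Qed.

Theorem proposition2p1 (G : groupType) (H : set G) :
  residually_finite (Aut G) -> AS_subgroup H ->
  splits_virtually (Aut_to_Out G) /\ residually_finite (Out G).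
Proof.
move=> rfA [_ finker finim].
have sC := Aut_fixing_subgroup H.
have [L fL finj] := finite_index_inj_on rfA sC finker.
have sCL := is_subgroupI sC (proj1 fL).
have fCL := finite_index_imageI sC finim fL.
split; first exact: splits_virtually_inj_on sCL fCL finj.
exact: residually_finite_inj_on rfA sCL fCL finj.
Qed.
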